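(* Let $n=2$ and let $\Gamma=(\Gamma^i_{jk})_{i,j,k=1}^2$ be a real trilinear (completely symmetric) tensor. Write $a_3=\Gamma^1_{11}$, $a_2=\Gamma^2_{11}=\Gamma^1_{12}$, $a_1=\Gamma^1_{22}=\Gamma^2_{12}$, $a_0=\Gamma^2_{22}$. Then the coupled KPZ system with coupling constants $\Gamma$ is fully decoupleable if and only if $$a_2(a_2-a_0)=a_1(a_3-a_1).$$
   Context: The coupled KPZ system is $\partial_t h^i=\tfrac12\Delta h^i+\tfrac12\sum_{j,k}\Gamma^i_{jk}\nabla h^j\nabla h^k+\xi^i$, $1\le i\le n$ (with independent space-time white noises $\xi^i$); its decoupleability is a property of $\Gamma$ only, defined as follows. A real $n\times n\times n$ tensor is trilinear if $\Gamma^i_{jk}=\Gamma^i_{kj}=\Gamma^j_{ik}$ for all $i,j,k$. The group $O(n)$ acts on trilinear tensors by $$(\sigma\circ\Gamma)^i_{jk}=\sum_{i',j',k'}\sigma_{ii'}\sigma_{jj'}\sigma_{kk'}\Gamma^{i'}_{j'k'} .$$ The system (equivalently, $\Gamma$) is fully decoupleable if there is $\sigma\in O(n)$ such that for every $i\in\{1,\dots,n\}$, $(\sigma\circ\Gamma)^i_{jk}=0$ for all $(j,k)\neq(i,i)$. *)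

(* Defs.v *)
From mathcomp Require Import all_boot all_order all_algebra.
From mathcomp Require Import reals.

Set Implicit Arguments.
Unset Strict Implicit.
Unset Printing Implicit Defensive.

Import GRing.Theory.
Local Open Scope ring_scope.

(* Coupling constants: [Gamma i j k] is $\Gamma^i_{jk}$; the indices 1, ..., n
   of the mathematics are the elements 0, ..., n - 1 of ['I_n]. *)
Definition tensor (R : realType) (n : nat) : Type := 'I_n -> 'I_n -> 'I_n -> R.

Definition trilinear (R : realType) (n : nat) (Gamma : tensor R n) : Prop :=
  forall i j k : 'I_n,
    Gamma i j k = Gamma i k j /\ Gamma i k j = Gamma j i k.

Definition orthogonal_mx (R : realType) (n : nat) (sigma : 'M[R]_n) : Prop :=
  sigma *m sigma^T = 1%:M.

Definition tensor_act (R : realType) (n : nat) (sigma : 'M[R]_n)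
    (Gamma : tensor R n) : tensor R n :=
  fun i j k => \sum_(i' < n) \sum_(j' < n) \sum_(k' < n)
    sigma i i' * sigma j j' * sigma k k' * Gamma i' j' k'.

(* Decoupleability of the coupled KPZ system depends on the coupling constants
   only, and is by definition this property of the tensor. *)
Definition fully_decoupleable (R : realType) (n : nat) (Gamma : tensor R n)
    : Prop :=
  exists sigma : 'M[R]_n, orthogonal_mx sigma /\
    forall i j k : 'I_n, (j, k) <> (i, i) -> tensor_act sigma Gamma i j k = 0.

(* Main.v *)
Require Import Defs.
From mathcomp Require Import all_boot all_order all_algebra.
From mathcomp Require Import reals.
From mathcomp Require Import ring lra.
Import GRing.Theory.
Local Open Scope ring_scope.

(** Viewing [Gamma] as the pair of symmetric matrices [Gamma 0] and [Gamma 1],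
    an orthonormal basis [u = (c, s)], [v = (- s, c)] decouples [Gamma] iff it
    diagonalises both matrices, that is, iff
    [(a3 - a1) c s = a2 (c^2 - s^2)] and [(a2 - a0) c s = a1 (c^2 - s^2)].
    Since the pair [(c^2 - s^2, 2 c s)] runs over all directions of the plane,
    this linear system is solvable by a unit vector [(c, s)] iff its
    determinant [a2 (a2 - a0) - a1 (a3 - a1)] vanishes. *)

Import Order.TTheory Num.Theory.

Lemma big_ord2 (V : nmodType) (F : 'I_2 -> V) : \sum_(i < 2) F i = F 0 + F 1.
Proof.
rewrite big_ord_recl big_ord1; congr (F _ + F _); exact: val_inj.
Qed.

Lemma ord2_ind (P : 'I_2 -> Prop) : P 0 -> P 1 -> forall i, P i.
Proof.
move=> P0 P1 [[|[|//]] lt_i].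
- by rewrite (_ : Ordinal lt_i = 0) //; apply: val_inj.
- by rewrite (_ : Ordinal lt_i = 1) //; apply: val_inj.
Qed.

(** The vector [(c, s)] must point along half the angle of [(x, 2 * y)]. Adding to that vector its
    length [d] along the first axis bisects the angle, so [(x + d, 2 * y)] is normalised; it is
    nonzero once [y != 0]. *)
Lemma exists_double_angle (R : rcfType) (x y : R) :
  exists c s : R, c ^+ 2 + s ^+ 2 = 1 /\ x * (c * s) = y * (c ^+ 2 - s ^+ 2).
Proof.
have [->|y0] := eqVneq y 0.
  by exists 1, 0; split; ring.
pose d := Num.sqrt (x ^+ 2 + 4 * y ^+ 2).
have d2 : d ^+ 2 = x ^+ 2 + 4 * y ^+ 2 by rewrite sqr_sqrtr; nra.
pose N := (x + d) ^+ 2 + (2 * y) ^+ 2.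
have N_gt0 : 0 < N.
  have y2 : 0 < y ^+ 2 by rewrite exprn_even_gt0.
  by rewrite /N; nra.
pose r := Num.sqrt N.
have r2 : r ^+ 2 = N by rewrite sqr_sqrtr // ltW.
have r0 : r != 0 by rewrite gt_eqF // sqrtr_gt0.
exists ((x + d) / r), (2 * y / r); split.
  have -> : ((x + d) / r) ^+ 2 + (2 * y / r) ^+ 2 = N / r ^+ 2.
    by rewrite /N; field.
  by rewrite r2 divff // gt_eqF.
apply/eqP; rewrite -subr_eq0.
have -> : x * ((x + d) / r * (2 * y / r))
          - y * (((x + d) / r) ^+ 2 - (2 * y / r) ^+ 2)
        = y * (x ^+ 2 + 4 * y ^+ 2 - d ^+ 2) / r ^+ 2 by field.
by rewrite d2 subrr mulr0 mul0r.
Qed.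

Lemma double_angle_system (R : rcfType) (x y z w : R) :
  (exists c s : R, [/\ c ^+ 2 + s ^+ 2 = 1,
     x * (c * s) = y * (c ^+ 2 - s ^+ 2) &
     z * (c * s) = w * (c ^+ 2 - s ^+ 2)])
  <-> y * z = w * x.
Proof.
split=> [[c [s [cs1 e1 e2]]]|det0].
  have unit4 : (c ^+ 2 - s ^+ 2) ^+ 2 + 4 * (c * s) ^+ 2 = 1.
    rewrite [LHS](_ : _ = (c ^+ 2 + s ^+ 2) ^+ 2); last by ring.
    by rewrite cs1 expr1n.
  apply/eqP; rewrite -subr_eq0; apply/eqP.
  (* Cramer's rule: the determinant times [C], and times [S], is a combination of the two equations.
     The weights [C] and [4 * S] recover the determinant through [unit4]. *)
  rewrite -[LHS]mulr1 -unit4.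
  set C := c ^+ 2 - s ^+ 2 in e1 e2 unit4 *; set S := c * s in e1 e2 unit4 *.
  rewrite [LHS](_ : _ = C * (x * (z * S - w * C) - z * (x * S - y * C))
    + 4 * S * (y * (z * S - w * C) - w * (x * S - y * C))); last by ring.
  by rewrite e1 e2; ring.
(* With zero determinant, a solution of a nonzero first equation also solves the second; if
   [x = y = 0], only the second remains. *)
have [x0|x0] := eqVneq x 0; last first.
  have [c [s [cs1 e1]]] := exists_double_angle R x y.
  exists c, s; split=> //; apply: (mulfI x0).
  by rewrite [LHS]mulrCA e1 [LHS]mulrA [z * y]mulrC det0; ring.
have [y0|y0] := eqVneq y 0; last first.
  have [c [s [cs1 e1]]] := exists_double_angle R x y.
  exists c, s; split=> //; apply: (mulfI y0).
  by rewrite [LHS]mulrA det0 -[LHS]mulrA e1; ring.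
have [c [s [cs1 e2]]] := exists_double_angle R z w.
by exists c, s; split=> //; rewrite x0 y0 !mul0r.
Qed.

Lemma trilinear2 (R : realType) (Gamma : tensor R 2) : trilinear Gamma ->
  [/\ Gamma 0 0 1 = Gamma 1 0 0, Gamma 0 1 0 = Gamma 1 0 0,
      Gamma 1 0 1 = Gamma 0 1 1 & Gamma 1 1 0 = Gamma 0 1 1].
Proof.
move=> G_tri; have [e1 e2] := G_tri 0 1 0; have [e3 e4] := G_tri 1 0 1.
by rewrite e1 e3 e2 e4.
Qed.

Lemma orthogonal_mx2 (R : realType) (sigma : 'M[R]_2) :
  orthogonal_mx sigma <->
  [/\ sigma 0 0 ^+ 2 + sigma 0 1 ^+ 2 = 1,
      sigma 0 0 * sigma 1 0 + sigma 0 1 * sigma 1 1 = 0 &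
      sigma 1 0 ^+ 2 + sigma 1 1 ^+ 2 = 1].
Proof.
split=> [/matrixP sigmaO|[s00 s01 s11]].
  have := (sigmaO 0 0, sigmaO 0 1, sigmaO 1 1).
  by rewrite !mxE !big_ord2 !mxE /= -!expr2 => -[[]].
apply/matrixP; apply: ord2_ind; apply: ord2_ind; rewrite !mxE big_ord2 !mxE //=.
by rewrite mulr0n -s01; ring.
Qed.

Lemma fully_decoupleable2P (R : realType) (Gamma : tensor R 2) :
  trilinear Gamma ->
  fully_decoupleable Gamma <->
  exists c s : R, [/\ c ^+ 2 + s ^+ 2 = 1,
    (Gamma 0 0 0 - Gamma 0 1 1) * (c * s) = Gamma 1 0 0 * (c ^+ 2 - s ^+ 2) &
    (Gamma 1 0 0 - Gamma 1 1 1) * (c * s) = Gamma 0 1 1 * (c ^+ 2 - s ^+ 2)].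
Proof.
move=> /trilinear2 [g001 g010 g101 g110].
split=> [[sigma [/orthogonal_mx2 [s00 s01 s11] dec]]|[c [s [cs1 e1 e2]]]].
  (* By symmetry, these two mixed entries represent all six. *)
  have b2 := dec 0 0 1 ltac:(by []); have b1 := dec 1 0 1 ltac:(by []).
  move: b1 b2; rewrite /tensor_act !big_ord2 g001 g010 g101 g110.
  move: s00 s01 s11; set p := sigma 0 0; set q := sigma 0 1.
  set r := sigma 1 0; set t := sigma 1 1.
  set a3 := Gamma 0 0 0; set a2 := Gamma 1 0 0.
  set a1 := Gamma 0 1 1; set a0 := Gamma 1 1 1.
  move=> s00 s01 s11 b1 b2; exists p, q.
  (* The determinant of [sigma], equal to 1 or -1 since reflections are allowed; the second row is
     [d] times the first one turned by a right angle. *)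
  pose d := p * t - q * r.
  have d2 : d ^+ 2 = 1.
    rewrite [LHS](_ : _ = (p ^+ 2 + q ^+ 2) * (r ^+ 2 + t ^+ 2)
                       - (p * r + q * t) ^+ 2); last by rewrite /d; ring.
    by rewrite s00 s01 s11; ring.
  have d0 : d != 0 by rewrite -sqrf_eq0 d2 oner_eq0.
  have rE : r = - (d * q).
    rewrite -[LHS]mulr1 -s00 [LHS](_ : _ = - (d * q) + p * (p * r + q * t)).
      by rewrite s01; ring.
    by rewrite /d; ring.
  have tE : t = d * p.
    rewrite -[LHS]mulr1 -s00 [LHS](_ : _ = d * p + q * (p * r + q * t)).
      by rewrite s01; ring.
    by rewrite /d; ring.
  (* [m0] and [m1] are the off-diagonal entries of [Gamma 0] and [Gamma 1] in
     the new basis; the mixed entries of the rotated tensor are their images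
     under the invertible [sigma]. *)
  pose m0 := (p * r) * a3 + (p * t + q * r) * a2 + (q * t) * a1.
  pose m1 := (p * r) * a2 + (p * t + q * r) * a1 + (q * t) * a0.
  have e2 : p * m0 + q * m1 = 0 by rewrite -b2 /m0 /m1; ring.
  have e1 : r * m0 + t * m1 = 0 by rewrite -b1 /m0 /m1; ring.
  have m00 : m0 = 0.
    apply: (mulfI d0).
    rewrite [LHS](_ : _ = t * (p * m0 + q * m1) - q * (r * m0 + t * m1)).
      by rewrite e1 e2; ring.
    by rewrite /d; ring.
  have m10 : m1 = 0.
    apply: (mulfI d0).
    rewrite [LHS](_ : _ = p * (r * m0 + t * m1) - r * (p * m0 + q * m1)).
      by rewrite e1 e2; ring.
    by rewrite /d; ring.
  (* Substituting the second row turns [m0] and [m1] into [d] times the differences of the sides of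
     the two equations. *)
  split=> //; apply/eqP; rewrite eq_sym -subr_eq0; apply/eqP; apply: (mulfI d0).
    by rewrite mulr0 -m00 /m0 rE tE; ring.
  by rewrite mulr0 -m10 /m1 rE tE; ring.
pose sigma : 'M[R]_2 :=
  \matrix_(i, j) (if i == 0 then if j == 0 then c else s
                  else if j == 0 then - s else c).
have [s00 s01 s10 s11] : [/\ sigma 0 0 = c, sigma 0 1 = s,
    sigma 1 0 = - s & sigma 1 1 = c] by rewrite !mxE.
exists sigma; split.
  by apply/orthogonal_mx2; rewrite s00 s01 s10 s11; split=> //;
     rewrite -?cs1; ring.
pose m0 := (Gamma 0 0 0 - Gamma 0 1 1) * (c * s)
           - Gamma 1 0 0 * (c ^+ 2 - s ^+ 2).
pose m1 := (Gamma 1 0 0 - Gamma 1 1 1) * (c * s)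
           - Gamma 0 1 1 * (c ^+ 2 - s ^+ 2).
have m00 : m0 = 0 by rewrite /m0 e1 subrr.
have m10 : m1 = 0 by rewrite /m1 e2 subrr.
(* Here [m0] and [m1] are minus the off-diagonal entries for the rotation [sigma], whence the signs;
   each mixed entry is one of these two expressions. *)
have b2 : - (c * m0 + s * m1) = 0 by rewrite m00 m10; ring.
have b1 : s * m0 - c * m1 = 0 by rewrite m00 m10; ring.
apply: ord2_ind; apply: ord2_ind; apply: ord2_ind => // _;
  rewrite /tensor_act !big_ord2 g001 g010 g101 g110 s00 s01 s10 s11;
  solve [rewrite -[RHS]b2 /m0 /m1; ring | rewrite -[RHS]b1 /m0 /m1; ring].
Qed.

Theorem proposition2p4 (R : realType) (Gamma : tensor R 2)
    (Gamma_trilinear : trilinear Gamma) :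
  let a3 := Gamma 0 0 0 in
  let a2 := Gamma 1 0 0 in
  let a1 := Gamma 0 1 1 in
  let a0 := Gamma 1 1 1 in
  fully_decoupleable Gamma <-> a2 * (a2 - a0) = a1 * (a3 - a1).
Proof.
move=> a3 a2 a1 a0.
rewrite (fully_decoupleable2P R Gamma Gamma_trilinear).
(* Taking [x = a3 - a1], [y = a2], [z = a2 - a0], [w = a1] makes [y * z = w * x] the criterion. *)
exact: double_angle_system.
Qed.
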